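(* Let $m,n\ge 2$ be integers and let $K_m$, $K_n$ be the complete graphs on $m$ and $n$ vertices. The sparing number of the corona $K_m\odot K_n$ is $$\varphi(K_m\odot K_n)=\tfrac12\left[(m-1)(m-2)+mn(n-1)\right].$$
   Context: All graphs are simple, finite and without isolated vertices. $\mathbb{N}_0$ is the set of non-negative integers; for finite $A,B\subseteq\mathbb{N}_0$, $A+B=\{a+b: a\in A, b\in B\}$. An integer additive set-indexer (IASI) of a graph $G$ is an injective function $f:V(G)\to\mathcal{P}(\mathbb{N}_0)$, with finite sets as values, such that the induced function $f^+:E(G)\to\mathcal{P}(\mathbb{N}_0)$, $f^+(uv)=f(u)+f(v)$, is also injective. An IASI $f$ is weak if $|f^+(uv)|=\max(|f(u)|,|f(v)|)$ for every edge $uv\in E(G)$. A vertex $v$ (edge $e$) is mono-indexed if $|f(v)|=1$ ($|f^+(e)|=1$). The sparing number $\varphi(G)$ is the minimum, over all weak IASIs of $G$, of the number of mono-indexed edges of $G$. The corona $G_1\odot G_2$ is obtained by taking one copy of $G_1$ and $|V(G_1)|$ copies of $G_2$, and joining the $i$-th vertex of $G_1$ to every vertex of the $i$-th copy of $G_2$. *)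

(* Defs.v *)
From mathcomp Require Import all_boot.
From mathcomp Require Import finmap.
From mathcomp Require Import boolp.

Set Implicit Arguments.
Unset Strict Implicit.
Unset Printing Implicit Defensive.

Record graph := Graph {
  vertex :> finType;
  adj : rel vertex;
  adj_sym : symmetric adj;
  adj_irr : irreflexive adj }.

Definition edges (G : graph) : {set {set G}} :=
  [set [set p.1; p.2] | p : G * G & adj p.1 p.2].

Definition no_isolated (G : graph) : Prop :=
  forall u : G, exists v : G, adj u v.

Section Constructions.

Definition complete_rel n : rel 'I_n := fun i j => i != j.

Lemma complete_sym n : symmetric (@complete_rel n).
Proof. by move=> i j; rewrite /complete_rel eq_sym. Qed.

Lemma complete_irr n : irreflexive (@complete_rel n).
Proof. by move=> i; rewrite /complete_rel eqxx. Qed.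

Definition complete n : graph := Graph (@complete_sym n) (@complete_irr n).

Variables G1 G2 : graph.

(* [inl u] is the vertex u of G1; [inr (u, x)] is the vertex x of the copy of
   G2 attached to u. *)
Definition corona_rel : rel (G1 + G1 * G2) := fun a b =>
  match a, b with
  | inl u, inl v => adj u v
  | inl u, inr q => u == q.1
  | inr p, inl v => p.1 == v
  | inr p, inr q => (p.1 == q.1) && adj p.2 q.2
  end.

Lemma corona_sym : symmetric corona_rel.
Proof.
by case=> [u|[u x]] [v|[v y]] //=; rewrite 1?eq_sym 1?[in LHS]adj_sym.
Qed.

Lemma corona_irr : irreflexive corona_rel.
Proof. by case=> [u|[u x]] /=; rewrite adj_irr ?andbF. Qed.

Definition corona : graph := Graph corona_sym corona_irr.

End Constructions.

Lemma complete_no_isolated n : 1 < n -> no_isolated (complete n).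
Proof.
case: n => [|[|n]] // _ i; exists (if i == ord0 then ord_max else ord0).
by rewrite /= /complete_rel; case: (eqVneq i ord0) => // ->.
Qed.

Lemma corona_no_isolated (G1 G2 : graph) :
  no_isolated G1 -> no_isolated (corona G1 G2).
Proof.
move=> h [u|[u x]]; last by exists (inl u); rewrite /= eqxx.
by have [v uv] := h u; exists (inl v).
Qed.

Definition sumset (A B : {fset nat}) : {fset nat} :=
  [fset (a + b)%N | a in A, b in B]%fset.

Lemma sumsetC : commutative sumset.
Proof.
move=> A B; apply/fsetP => x; apply/imfset2P/imfset2P => -[a aA [b bB ->]];
by exists b => //; exists a => //; rewrite addnC.
Qed.

Lemma sumset0 A : sumset A [fset 0%N]%fset = A.
Proof.
apply/fsetP => x; apply/imfset2P/idP => [[a aA [b]]|xA].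
  by rewrite !inE => /eqP -> ->; rewrite addn0.
by exists x => //; exists 0; rewrite ?inE ?addn0.
Qed.

Section Indexers.

Variable G : graph.
Implicit Types (f : G -> {fset nat}) (u v : G).

(* The induced function of f: on an edge {u, v} it is f u + f v, see
   [inducedE]. *)
Definition induced f (e : {set G}) : {fset nat} :=
  \big[sumset/[fset 0%N]%fset]_(w in e) f w.

Lemma inducedE f u v : adj u v -> induced f [set u; v] = sumset (f u) (f v).
Proof.
move=> uv; have nuv : u != v by apply: contraTneq uv => ->; rewrite adj_irr.
rewrite /induced -big_filter.
have : perm_eq [seq w <- index_enum G | w \in [set u; v]] [:: u; v].
  apply: uniq_perm; rewrite ?filter_uniq ?index_enum_uniq //= ?inE ?nuv // => w.
  by rewrite mem_filter mem_index_enum andbT !inE.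
case: (filter _ _) => [|a [|b [|c s]]] P; have := perm_size P => //= _.
rewrite !big_cons big_nil sumset0.
have : a \in [:: u; v] by rewrite -(perm_mem P) inE eqxx.
rewrite !inE => /orP [] /eqP ea; subst a.
  by move: P; rewrite perm_cons => /perm_mem/(_ v); rewrite !inE eqxx => /eqP ->.
have : u \in [:: v; b] by rewrite (perm_mem P) inE eqxx.
by rewrite !inE (negbTE nuv) /= => /eqP ->; rewrite sumsetC.
Qed.

Definition IASI f : Prop :=
  injective f /\ {in edges G &, injective (induced f)}.

Definition weak_IASI f : Prop :=
  IASI f /\ forall u v, adj u v ->
    #|` induced f [set u; v]|%fset = maxn #|` f u|%fset #|` f v|%fset.

Definition mono_edges f : {set {set G}} :=
  [set e in edges G | #|` induced f e|%fset == 1].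

Lemma pow2_sidon i j k l : i < j -> k < l ->
  2 ^ i + 2 ^ j = 2 ^ k + 2 ^ l -> i = k /\ j = l.
Proof.
move=> ij kl e.
have bound a b c d : a < b -> c < d -> b < d -> 2 ^ a + 2 ^ b < 2 ^ c + 2 ^ d.
  move=> ab cd bd; apply: (@leq_trans (2 ^ d).+1).
    rewrite ltnS; apply: (@leq_trans (2 ^ b.+1)); last by rewrite leq_exp2l.
    by rewrite expnS mul2n -addnn leq_add2r leq_exp2l // ltnW.
  by rewrite -add1n leq_add2r expn_gt0.
have jl : j = l.
  by case: (ltngtP j l) => // h; [have := bound _ _ _ _ ij kl h |
     have := bound _ _ _ _ kl ij h]; rewrite e ltnn.
split=> //; move: e; rewrite jl => /addIn /eqP.
by rewrite eqn_exp2l // => /eqP.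
Qed.

Lemma exists_weak_IASI : exists f, weak_IASI f.
Proof.
pose f u : {fset nat} := [fset (2 ^ enum_rank u)%N]%fset.
have fS u v : sumset (f u) (f v) = [fset (2 ^ enum_rank u + 2 ^ enum_rank v)%N]%fset.
  apply/fsetP => x; rewrite inE; apply/imfset2P/eqP.
    by case=> a; rewrite inE => /eqP -> [b]; rewrite inE => /eqP -> ->.
  by move=> ->; exists (2 ^ enum_rank u); rewrite ?inE //;
     exists (2 ^ enum_rank v); rewrite ?inE.
have edgeP e : e \in edges G -> exists u v,
    [/\ enum_rank u < enum_rank v, adj u v & e = [set u; v]].
  case/imsetP => -[u v]; rewrite inE /= => uv ->.
  case: (ltngtP (enum_rank u) (enum_rank v)) => h.
  - by exists u, v.
  - by exists v, u; rewrite adj_sym setUC.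
  by move: uv; rewrite (enum_rank_inj (val_inj h)) adj_irr.
exists f; split; last first.
  by move=> u v uv; rewrite inducedE // fS !cardfs1.
split.
  move=> u v /fsetP /(_ (2 ^ enum_rank u)); rewrite !inE eqxx => /esym.
  by rewrite eqn_exp2l // => /eqP /val_inj /enum_rank_inj.
move=> e1 e2 /edgeP [u [v [uv auv ->]]] /edgeP [x [y [xy axy ->]]].
rewrite !inducedE // !fS.
move=> /fsetP /(_ (2 ^ enum_rank u + 2 ^ enum_rank v)).
rewrite !inE eqxx => /esym/eqP /(pow2_sidon uv xy) [].
by move=> /val_inj /enum_rank_inj -> /val_inj /enum_rank_inj ->.
Qed.

Lemma exists_mono_count :
  exists k, `[< exists f, weak_IASI f /\ #|mono_edges f| = k >].
Proof.
by have [f wf] := exists_weak_IASI; exists #|mono_edges f|; apply/asboolP; exists f.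
Qed.

Definition sparing_number : nat := ex_minn exists_mono_count.

End Indexers.

(* Main.v *)
Require Import Defs.
From mathcomp Require Import all_boot all_order all_algebra.
From mathcomp Require Import finmap boolp ring zify.

(** In a weak IASI the vertices whose label is not a singleton form a stable
    set, because [A + B] is strictly larger than both [A] and [B] as soon as both
    have at least two elements; conversely every stable set arises in this way.
    So the sparing number is the least number of edges avoiding a stable set.
    The edges of [K_m] corona [K_n] are partitioned into those of the clique [K_m]
    and those of [m] cliques [K_(n+1)].  A stable set meets a clique [Q] at most
    once, hence leaves at least ['C(#|Q|.-1, 2)] of its edges, and a vertex of
    [K_m] together with one vertex in each copy of [K_n] attached to the other
    vertices is a stable set meeting all these cliques. *)

Import GRing.Theory.

(** For [b < b'] in [B], the translate of [A] by [b] lies in the sumset and has as many elements as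
    [A], while the maximum of [A] plus [b'] exceeds every element of that translate. *)
Lemma card_sumset_gt (A B : {fset nat}) :
  (0 < #|` A|)%fset -> (1 < #|` B|)%fset -> (#|` A| < #|` sumset A B|)%fset.
Proof.
rewrite !cardfE => /card_gt0P [a0 _] /card_gt1P [b [b' [_ _]]].
wlog bb' : b b' / val b < val b' => [hw ne|_].
  have [lt|gt|eq] := ltngtP (val b) (val b'); first exact: (hw b b').
    by apply: (hw b' b); rewrite // eq_sym.
  by rewrite (val_inj eq) eqxx in ne.
rewrite -!cardfE; case: (@arg_maxnP A a0 xpredT val) => // M _ maxM.
have <- : #|` [fset (a + val b)%N | a in A]%fset| = #|` A|.
  by apply: card_imfset => x y /addIn.
apply: fproper_ltn_card; rewrite fproperE; apply/andP; split.
  apply/fsubsetP => x /imfsetP [a aA ->].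
  by apply/imfset2P; exists a => //; exists (val b) => //; apply: valP.
apply/fsubsetPn; exists (val M + val b').
  by apply/imfset2P; exists (val M); [apply: valP | exists (val b') => //; apply: valP].
apply/imfsetP => -[a /= aA E]; have /= leM := maxM [` aA]%fset isT.
by have := leq_add leM bb'; rewrite addnS E ltnn.
Qed.

(** * Weak IASIs and stable sets *)

Section StableSets.

Variable G : graph.
Implicit Types (f : G -> {fset nat}) (u v : G) (S T : {set G}).

Definition stable S : Prop := {in S &, forall u v, ~~ adj u v}.

Definition edges_avoiding S : {set {set G}} :=
  [set e in edges G | [disjoint e & S]].

Lemma edgesP e :
  reflect (exists u v, adj u v /\ e = [set u; v]) (e \in edges G).
Proof.
apply: (iffP imsetP) => [[[u v]]|[u [v [uv ->]]]].
  by rewrite inE => uv ->; exists u, v.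
by exists (u, v); rewrite ?inE.
Qed.

Lemma disjoint_set2 u v S :
  [disjoint [set u; v] & S] = (u \notin S) && (v \notin S).
Proof. by rewrite disjoints_subset subUset !sub1set !inE. Qed.

(** An empty label at [u] makes every sumset with it empty, so weakness empties the label of a
    neighbour too, against injectivity. *)
Lemma weak_IASI_card_gt0 f u :
  no_isolated G -> weak_IASI f -> (0 < #|` f u|)%fset.
Proof.
move=> iso [[finj _] fw]; rewrite cardfs_gt0; apply/negP => /eqP fu0.
have [v uv] := iso u.
have := fw u v uv; rewrite inducedE // fu0 cardfs0 max0n.
have -> : sumset fset0 (f v) = fset0.
  by apply/fsetP => x; rewrite inE; apply/imfset2P => -[a]; rewrite inE.
rewrite cardfs0 => /esym/eqP; rewrite cardfs_eq0 => /eqP fv0.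
by move: uv; rewrite (finj u v) ?adj_irr // fu0 fv0.
Qed.

Lemma weak_IASI_stable f : no_isolated G -> weak_IASI f ->
  exists2 S, stable S & mono_edges f = edges_avoiding S.
Proof.
move=> iso wf; have f0 u := weak_IASI_card_gt0 f u iso wf.
case: (wf) => _ fw.
exists [set v | (1 < #|` f v|)%fset].
  move=> u v; rewrite !inE => fu fv; apply/negP => uv.
  have := fw u v uv; rewrite inducedE //.
  have := card_sumset_gt _ _ (f0 u) fv; have := card_sumset_gt _ _ (f0 v) fu.
  by rewrite (sumsetC (f v)); lia.
apply/setP => e; rewrite !inE; case: edgesP => //= -[u [v [uv ->]]].
(* As labels are nonempty, the maximum of two label sizes is 1 exactly when neither exceeds 1. *)
by rewrite fw // disjoint_set2 !inE -!leqNgt -geq_max eqn_leq leq_max f0 andbT.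
Qed.

(** [a] and [c] are the least elements of the two sets. *)
Lemma fset_pair_inj (a b c d : nat) :
  [fset a; (a + b)%N]%fset = [fset c; (c + d)%N]%fset -> a = c.
Proof.
move=> /fsetP h; have := h a; have := h c; rewrite !inE !eqxx /=.
by move=> /orP[] /eqP ? /esym /orP[] /eqP ?; lia.
Qed.

(** A vertex of rank [r] gets [2 ^ r], together with its successor if it lies in [S]. An edge has at
    most one end in [S], so its label has at most two elements; the least one is a sum of two
    distinct powers of 2, which determines the edge. *)
Lemma stable_weak_IASI S : stable S ->
  exists2 f, weak_IASI f & mono_edges f = edges_avoiding S.
Proof.
move=> stS; pose p u := 2 ^ enum_rank u.
pose f u : {fset nat} := [fset p u; (p u + (u \in S))%N]%fset.
have fE u v : adj u v -> induced f [set u; v] =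
    [fset (p u + p v)%N; (p u + p v + ((u \in S) || (v \in S)))%N]%fset.
  move=> uv; rewrite inducedE //.
  have nS : ~~ ((u \in S) && (v \in S)).
    by apply/andP => -[uS vS]; have := stS u v uS vS; rewrite uv.
  apply/fsetP => x; rewrite !inE; apply/imfset2P/orP.
    case=> a /=; rewrite !inE => ha [b /=]; rewrite !inE => hb ->.
    move: nS ha hb; case: (u \in S); case: (v \in S) => //= _; lia.
  (* If [x] is not the least sum, its surplus 1 is taken from the end that lies in [S]. *)
  move=> h; exists (if (u \in S) && (x != p u + p v) then p u + 1 else p u).
    by rewrite /= !inE; case: ifP => [/andP[-> _]|_]; rewrite eqxx ?orbT.
  exists (if (v \in S) && (x != p u + p v) then p v + 1 else p v).
    by rewrite /= !inE; case: ifP => [/andP[-> _]|_]; rewrite eqxx ?orbT.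
  move: nS h; case: (u \in S); case: (v \in S) => //= _; case: eqP => /=; lia.
have fC u : #|` f u|%fset = (u \in S).+1.
  by rewrite cardfs2; congr _.+1; case: (u \in S); lia.
have fEC u v : adj u v ->
    #|` induced f [set u; v]|%fset = ((u \in S) || (v \in S)).+1.
  by move=> uv; rewrite fE // cardfs2; congr _.+1; case: (_ || _); lia.
have edgeP e : e \in edges G -> exists u v,
    [/\ enum_rank u < enum_rank v, adj u v & e = [set u; v]].
  case/edgesP => u [v [uv ->]].
  case: (ltngtP (enum_rank u) (enum_rank v)) => h.
  - by exists u, v.
  - by exists v, u; rewrite adj_sym setUC.
  by move: uv; rewrite (enum_rank_inj (val_inj h)) adj_irr.
exists f.
  split; last first.
    by move=> u v uv; rewrite fEC // !fC; case: (u \in S); case: (v \in S).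
  split.
    move=> u v /fset_pair_inj /eqP.
    by rewrite eqn_exp2l // => /eqP /val_inj /enum_rank_inj.
  move=> e1 e2 /edgeP [u [v [uv auv ->]]] /edgeP [x [y [xy axy ->]]].
  rewrite !fE // => /fset_pair_inj /(pow2_sidon uv xy) [].
  by move=> /val_inj /enum_rank_inj -> /val_inj /enum_rank_inj ->.
apply/setP => e; rewrite !inE; case: edgesP => //= -[u [v [uv ->]]].
by rewrite fEC // disjoint_set2; case: (u \in S); case: (v \in S).
Qed.

Lemma sparing_number_stable k : no_isolated G ->
  (forall S, stable S -> k <= #|edges_avoiding S|) ->
  (exists2 S, stable S & #|edges_avoiding S| = k) ->
  sparing_number G = k.
Proof.
move=> iso lb [S stS Sk]; rewrite /sparing_number.
case: ex_minnP => j /asboolP [f [wf fj]] jmin; apply/eqP; rewrite eqn_leq.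
apply/andP; split.
  have [g wg gE] := stable_weak_IASI S stS.
  by apply: jmin; apply/asboolP; exists g; rewrite gE.
by have [T stT fT] := weak_IASI_stable f iso wf; rewrite -fj fT lb.
Qed.

(** * Graphs whose edges are partitioned into cliques *)

Section CliquePartition.

Variables (I : finType) (Q : I -> {set G}).
Hypothesis clique_Q : forall k, {in Q k &, forall u v, u != v -> adj u v}.
Hypothesis cover_Q : forall u v, adj u v -> exists k, (u \in Q k) && (v \in Q k).
Hypothesis linear_Q : forall k l, k != l -> #|Q k :&: Q l| <= 1.

(** Each edge lies in exactly one clique: [cover_Q] provides one, and two would share both ends,
    against [linear_Q]. Inside [Q k], the edges avoiding [S] are all the pairs of [Q k :\: S]. *)
Lemma card_edges_avoiding S :
  #|edges_avoiding S| = \sum_k 'C(#|Q k :\: S|, 2).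
Proof.
pose F k := [set e : {set G} | e \subset Q k :\: S & #|e| == 2].
under eq_bigr => k _ do rewrite -cards_draws -/(F k) -sum1_card.
rewrite -partition_disjoint_bigcup => [|k l kl]; last first.
  rewrite disjoint_subset; apply/subsetP => e.
  rewrite !inE !subsetD => /andP [/andP [ek _] /eqP e2].
  apply/negP => /andP [/andP [el _] _].
  have: #|e| <= #|Q k :&: Q l| by rewrite subset_leq_card // subsetI ek.
  by rewrite e2 => /leq_trans/(_ (linear_Q k l kl)).
rewrite sum1_card; apply: eq_card => e; rewrite inE; apply/andP/bigcupP.
  case=> /edgesP [u [v [uv ->]]] dS; have [k /andP [uk vk]] := cover_Q u v uv.
  have nuv : u != v by apply: contraTneq uv => ->; rewrite adj_irr.
  exists k => //; rewrite inE subsetD dS andbT cards2 nuv andbT.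
  by rewrite subUset !sub1set uk vk.
case=> k _; rewrite inE subsetD => /andP [/andP [eQ dS] /cards2P [u [v [nuv E]]]].
split=> //; apply/edgesP; exists u, v; split=> //.
by move: eQ; rewrite E subUset !sub1set => /andP [uk vk]; apply: (clique_Q k).
Qed.

Lemma card_clique_stable S k : stable S -> #|Q k :&: S| <= 1.
Proof.
move=> stS; rewrite leqNgt; apply/card_gt1P => -[u [v []]].
rewrite !inE => /andP [uk uS] /andP [vk vS] nuv.
by have := stS u v uS vS; rewrite (clique_Q k).
Qed.

(** The lower bounds for the single cliques add up, and a stable set meeting every clique attains
    all of them at once. *)
Lemma sparing_number_cliques S : no_isolated G -> stable S ->
  (forall k, exists2 u, u \in Q k & u \in S) ->
  sparing_number G = \sum_k 'C(#|Q k|.-1, 2).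
Proof.
move=> iso stS QS; apply: sparing_number_stable => //.
  move=> T stT; rewrite card_edges_avoiding; apply: leq_sum => k _.
  apply: leq_bin2l; have := card_clique_stable T k stT.
  by rewrite cardsD; lia.
exists S => //; rewrite card_edges_avoiding; apply: eq_bigr => k _.
have [u uk uS] := QS k; have := card_clique_stable S k stS.
have: 0 < #|Q k :&: S| by apply/card_gt0P; exists u; rewrite inE uk.
by rewrite cardsD => ? ?; congr 'C(_, 2); lia.
Qed.

End CliquePartition.

End StableSets.

(** * The cliques of the corona *)

Section CoronaCliques.

Variables m n : nat.
Local Notation V := ('I_m + 'I_m * 'I_n)%type.

Definition corona_clique (k : option 'I_m) :
    {set corona (complete m) (complete n)} :=
  match k with
  | None => [set inl i | i : 'I_m]
  | Some i => inl i |: [set inr (i, x) | x : 'I_n]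
  end.

Lemma in_corona_clique k (a : V) : (a \in corona_clique k) =
  match k, a with
  | None, inl _ => true
  | None, inr _ => false
  | Some i, inl j => j == i
  | Some i, inr q => q.1 == i
  end.
Proof.
case: k => [i|]; case: a => [j|[j x]]; rewrite /= ?inE.
- apply/orP/eqP => [[/eqP[->]|/imsetP []]|->] //.
  by left; rewrite eqxx.
- apply/orP/eqP => /= [[//|/imsetP [y _ [-> _]] //]|->].
  by right; apply/imsetP; exists x.
- by apply/imsetP; exists j.
- by apply/imsetP => -[].
Qed.

Lemma card_corona_clique k :
  #|corona_clique k| = if k is Some _ then n.+1 else m.
Proof.
case: k => [i|] /=; last by rewrite card_imset ?card_ord // => i j [].
rewrite cardsU1 card_imset ?card_ord => [|x y []//].
by case: imsetP => // -[].
Qed.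

Lemma sparing_number_corona_complete : 1 < m -> 1 < n ->
  sparing_number (corona (complete m) (complete n)) =
  'C(m.-1, 2) + m * 'C(n, 2).
Proof.
move=> m1 n1; pose i0 := Ordinal (ltnW m1); pose x0 := Ordinal (ltnW n1).
(* The vertex [inl i0] serves both the clique [None] and the clique [Some i0]; the copy attached to
   [i0] is left out because its vertices are adjacent to [inl i0]. *)
pose S : {set corona (complete m) (complete n)} :=
  [set a : V | match a with inl i => i == i0
               | inr q => (q.1 != i0) && (q.2 == x0) end].
rewrite (@sparing_number_cliques _ _ corona_clique _ _ _ S).
- rewrite (bigD1 None) // (card_corona_clique None); congr (_ + _).
  rewrite (reindex_omap Some id) => [|[]//] /=.
  rewrite (eq_bigr (fun=> 'C(n, 2))) => [|i _]; last first.
    by rewrite (card_corona_clique (Some i)).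
  by rewrite (eq_bigl xpredT) ?sum_nat_const ?card_ord // => i; rewrite eqxx.
- move=> k [i|[i x]] [j|[j y]]; rewrite !in_corona_clique; case: k => [k|] //=.
  + by move=> /eqP -> /eqP ->; rewrite eqxx.
  + by move=> /eqP -> /eqP ->; rewrite eqxx.
  + move=> /eqP -> /eqP ->; rewrite eqxx /= /complete_rel.
    by apply: contra => /eqP ->.
- move=> [i|[i x]] [j|[j y]] /= => [_|/eqP ->|/eqP ->|/andP [/eqP -> _]].
  + by exists None; rewrite !in_corona_clique.
  + by exists (Some j); rewrite !in_corona_clique /= !eqxx.
  + by exists (Some j); rewrite !in_corona_clique /= !eqxx.
  + by exists (Some j); rewrite !in_corona_clique /= !eqxx.
(* The cliques [None] and [Some i] share only [inl i]; two distinct cliques [Some i] and [Some j]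
   are disjoint. *)
- move=> k l kl; rewrite leqNgt; apply/card_gt1P => -[a [b []]].
  rewrite !inE !in_corona_clique; move: kl.
  case: k l a b => [k|] [l|] [i|[i x]] [j|[j y]] //= kl;
    do ?[move=> /andP[/eqP ? /eqP ?] | move=> /eqP ?]; subst;
    by rewrite ?eqxx in kl *.
- exact/corona_no_isolated/complete_no_isolated.
- move=> [i|[i x]] [j|[j y]]; rewrite !inE /=.
  + by move=> /eqP -> /eqP ->; rewrite /complete_rel eqxx.
  + by move=> /eqP -> /andP []; rewrite eq_sym.
  + by move=> /andP [? _] /eqP ->.
  + by move=> /andP [_ /eqP ->] /andP [_ /eqP ->]; rewrite /complete_rel eqxx andbF.
- case=> [i|]; last by exists (inl i0); rewrite ?in_corona_clique ?inE.
  have [->|ne] := eqVneq i i0.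
    by exists (inl i0); rewrite ?in_corona_clique ?inE.
  by exists (inr (i, x0)); rewrite ?in_corona_clique ?inE //= ne /=.
Qed.

End CoronaCliques.

(** * Closed form over the rationals *)

Local Open Scope ring_scope.

(** The absorption identity gives twice the binomial coefficient; working in a field avoids
    truncated subtraction and division. *)
Lemma natr_bin2 (F : numFieldType) k :
  'C(k, 2)%:R = k%:R * (k%:R - 1) / 2%:R :> F.
Proof.
case: k => [|k]; first by rewrite !mul0r.
have h : 2%:R * 'C(k.+1, 2)%:R = k.+1%:R * k%:R :> F.
  by rewrite -!natrM -mul_bin_diag bin1.
have nz : 2%:R != 0 :> F by rewrite Num.Theory.pnatr_eq0.
by rewrite -[LHS](mulKf nz) h -(natr1 k) addrK mulrC.
Qed.

Theorem theorem2p8 (m n : nat) (hm : (2 <= m)%N) (hn : (2 <= n)%N) :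
  (sparing_number (corona (complete m) (complete n)))%:R =
  1 / 2%:R * ((m%:R - 1) * (m%:R - 2%:R) + m%:R * n%:R * (n%:R - 1)) :> rat.
Proof.
rewrite sparing_number_corona_complete // natrD natrM !natr_bin2.
(* Since [m] is positive, [m.-1] casts to [m - 1] without truncation, whence the factor [m - 2]. *)
by rewrite -subn1 natrB ?(ltnW hm) //; field.
Qed.
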